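(* Let $R$ be a field, $A$ a commutative $R$-algebra with identity $1_A$ of finite dimension $n>0$ over $R$, and $L=[,]$ a Lie bracket operation on $A$. Let $\Gamma(L)=\{a\in A:[ax,y]=a[x,y]\text{ for all }x,y\in A\}$. Suppose $\{\varepsilon_1,\dots,\varepsilon_p\}$ is a basis of $\Gamma(L)$ and $\{\varepsilon_1,\dots,\varepsilon_p,\delta_1,\dots,\delta_q\}$ is a basis of $A$, with $p,q>0$, $p+q=n$, and for $1\le i\le p$, $1\le j\le q$ write $$\varepsilon_i\delta_j=\sum_{1\le k\le p}a_k^{(i,j)}\varepsilon_k+\sum_{1\le k\le q}b_k^{(i,j)}\delta_k,\qquad [1_A,\delta_j]=\sum_{1\le k\le p}c_k^{(j)}\varepsilon_k-\sum_{1\le k\le q}d_k^{(j)}\delta_k,$$ with coefficients in $R$. For $1\le j\le q$ let $B_j$ be the $q\times p$ matrix whose $(k,i)$ entry is $b_k^{(i,j)}$, and let $\beta_j=(d_1^{(j)},\dots,d_q^{(j)})^T$. Then $L$ is induced by an averaging operator on $A$ if and only if $$[x,y]=x[1_A,y]+y[x,1_A]\quad\text{for all }x,y\in A$$ and the system of linear equations $$\begin{bmatrix} B_1 \\ B_2 \\ \vdots \\ B_q \end{bmatrix} \begin{bmatrix} x_1 \\ x_2 \\ \vdots \\ x_p \end{bmatrix} = \begin{bmatrix} \beta_1 \\ \beta_2 \\ \vdots \\ \beta_q \end{bmatrix}$$ has a solution in $R^p$.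
   Context: An averaging operator on $A$ is an $R$-linear map $f:A\to A$ with $f(xf(y))=f(x)f(y)$ for all $x,y\in A$. A Lie bracket operation on $A$ is an $R$-bilinear operation $[,]:A\times A\to A$ with $[x,x]=0$ and $[[x,y],z]+[[y,z],x]+[[z,x],y]=0$ for all $x,y,z\in A$. A Lie bracket operation $[,]$ is induced by an averaging operator $f$ if $[x,y]=xf(y)-yf(x)$ for all $x,y\in A$. $\Gamma(L)$ is a subalgebra of $A$ containing $\{r1_A:r\in R\}$. *)

(* Defs.v *)
From HB Require Import structures.
From mathcomp Require Export all_boot all_order all_algebra all_field.

Set Implicit Arguments.
Unset Strict Implicit.
Unset Printing Implicit Defensive.

Import GRing.Theory.
Local Open Scope ring_scope.

Definition averaging (R : fieldType) (A : falgType R) (f : {linear A -> A})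
    : Prop :=
  forall x y : A, f (x * f y) = f x * f y.

Definition lie_bracket (R : fieldType) (A : falgType R)
    (br : {bilinear A -> A -> A}) : Prop :=
  (forall x : A, br x x = 0) /\
  (forall x y z : A, br (br x y) z + br (br y z) x + br (br z x) y = 0).

Definition induced_by (R : fieldType) (A : falgType R)
    (br : {bilinear A -> A -> A}) (f : {linear A -> A}) : Prop :=
  forall x y : A, br x y = x * f y - y * f x.

(* Membership in $\Gamma(L)$. *)
Definition in_Gamma (R : fieldType) (A : falgType R)
    (br : {bilinear A -> A -> A}) (a : A) : Prop :=
  forall x y : A, br (a * x) y = a * br x y.

(* Main.v *)
(** If [f] is an averaging operator inducing the bracket, then [f y = [1, y] + y f(1)]
    and [f] takes its values in Gamma(L).  Conversely, for [e] in Gamma(L) the map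
    [y |-> [1, y] + y e] induces the bracket as soon as
    [[x, y] = x [1, y] + y [x, 1]], and it is averaging as soon as its values lie in
    Gamma(L).  On Gamma(L) itself this is automatic, since [[1, a] = 0] there; so only
    the [delta]-coordinates of the images of the [delta_j] matter.  For
    [e = \sum_i x_i eps_i] their vanishing is exactly the linear system. *)
Require Import Defs.
From mathcomp Require Import all_boot all_order all_algebra all_field.

Set Implicit Arguments.
Unset Strict Implicit.
Unset Printing Implicit Defensive.

Import GRing.Theory.
Local Open Scope ring_scope.

(** The [X]-part of the sum always lies in [<<X>>], so membership puts the [Y]-part in
    [<<X>> :&: <<Y>>]. Freeness of [X ++ Y] makes this intersection zero, and freeness of [Y] then
    kills every [v k]. *)
Lemma sum_free_cat_mem (K : fieldType) (V : vectType K) (p q : nat)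
    (X : p.-tuple V) (Y : q.-tuple V) (u : 'I_p -> K) (v : 'I_q -> K) :
  free (X ++ Y) ->
  \sum_(k < p) u k *: tnth X k + \sum_(k < q) v k *: tnth Y k \in <<X>>%VS <->
  forall k, v k = 0.
Proof.
have span_sum (m : nat) (Z : m.-tuple V) (w : 'I_m -> K) :
    \sum_(k < m) w k *: tnth Z k \in <<Z>>%VS.
  by apply: rpred_sum => k _; apply/rpredZ/memv_span/mem_tnth.
rewrite cat_free => /and3P[_ freeY /directv_addP capXY].
rewrite rpredDl //; split=> [sumX | v0]; last first.
  by rewrite big1 ?mem0v // => k _; rewrite v0 scale0r.
have: \sum_(k < q) v k *: tnth Y k \in (<<X>> :&: <<Y>>)%VS.
  by rewrite memv_cap sumX span_sum.
rewrite capXY memv0 => /eqP sum0; apply: (freeP freeY).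
by rewrite -[RHS]sum0; apply: eq_bigr => k _; rewrite -tnth_nth.
Qed.

Section InducedBracket.

Variables (R : fieldType) (A : falgType R).
Hypothesis mulA_comm : commutative (@GRing.mul A).
Variable br : {bilinear A -> A -> A}.

Lemma lie_bracket_antisym : lie_bracket br -> forall x y, br x y = - br y x.
Proof.
move=> [br_alt _] x y; apply/eqP; rewrite -addr_eq0; apply/eqP.
by have := br_alt (x + y); rewrite linearDl !linearDr !br_alt addr0 add0r.
Qed.

Lemma in_GammaM a b : in_Gamma br a -> in_Gamma br b -> in_Gamma br (a * b).
Proof. by move=> aP bP x y; rewrite -mulrA aP bP mulrA. Qed.

(** Writing [a = a * 1] gives [[a, 1] = a [1, 1] = 0]. *)
Lemma in_Gamma_br1 : lie_bracket br -> forall a, in_Gamma br a -> br 1 a = 0.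
Proof.
move=> br_lie a aP; rewrite (lie_bracket_antisym br_lie) -[X in br X]mulr1 aP.
by rewrite br_lie.1 mulr0 oppr0.
Qed.

Section Induced.

Variable f : {linear A -> A}.
Hypothesis br_f : induced_by br f.

Lemma induced_byE y : f y = br 1 y + y * f 1.
Proof. by rewrite br_f mul1r subrK. Qed.

(** On the right, the two terms [x y f(1)] cancel by commutativity. *)
Lemma induced_by_br1 x y : br x y = x * br 1 y + y * br x 1.
Proof.
rewrite !br_f !mul1r !mulrBr !mulrA [y * x]mulA_comm.
by rewrite addrA subrK.
Qed.

(** In [[f z * x, y] = f z * x * f y - y * f (f z * x)] the averaging identity turns [f (x * f z)]
    into [f x * f z], so [f z] factors out. *)
Lemma averaging_in_Gamma z : averaging f -> in_Gamma br (f z).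
Proof.
move=> f_avg x y; rewrite !br_f mulrBr mulrA; congr (_ - _).
by rewrite [f z * x]mulA_comm f_avg mulrA [RHS]mulA_comm.
Qed.

End Induced.

Section Shift.

Variables (e : A) (f : {linear A -> A}).
Hypothesis br_lie : lie_bracket br.
Hypothesis br_br1 : forall x y, br x y = x * br 1 y + y * br x 1.
Hypothesis fE : forall y, f y = br 1 y + y * e.

(** In [x * f y - y * f x] the contributions [x y e] of the shift cancel, for any [e]. *)
Lemma shift_induced_by : induced_by br f.
Proof.
move=> x y; rewrite br_br1 !fE [br x 1](lie_bracket_antisym br_lie).
by rewrite !mulrDr !mulrA [y * x]mulA_comm mulrN [y * _ + _]addrC addrKA.
Qed.

(** Since [f y] is in Gamma, antisymmetry gives [[1, f y * x] = f y * [1, x]]; adding [f y * x * e]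
    yields [f y * f x]. *)
Lemma shift_averaging : (forall y, in_Gamma br (f y)) -> averaging f.
Proof.
move=> fG x y; rewrite fE [x * _]mulA_comm (lie_bracket_antisym br_lie) fG.
by rewrite -mulrN -(lie_bracket_antisym br_lie) -mulrA -mulrDr -fE mulA_comm.
Qed.

End Shift.

End InducedBracket.

Theorem theorem4p8
    (R : fieldType) (A : falgType R) (mulA_comm : commutative (@GRing.mul A))
    (n : nat) (n_gt0 : (0 < n)%N) (dimA : \dim {:A} = n)
    (br : {bilinear A -> A -> A}) (br_lie : lie_bracket br)
    (Gamma : {vspace A}) (GammaP : forall a : A, a \in Gamma <-> in_Gamma br a)
    (p q : nat) (p_gt0 : (0 < p)%N) (q_gt0 : (0 < q)%N) (pqn : (p + q)%N = n)
    (eps : p.-tuple A) (delta : q.-tuple A)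
    (eps_basis : basis_of Gamma eps)
    (eps_delta_basis : basis_of {:A} (eps ++ delta))
    (a : 'I_p -> 'I_q -> 'I_p -> R) (b : 'I_p -> 'I_q -> 'I_q -> R)
    (c : 'I_q -> 'I_p -> R) (d : 'I_q -> 'I_q -> R)
    (eps_mul_delta : forall (i : 'I_p) (j : 'I_q),
       tnth eps i * tnth delta j =
         \sum_(k < p) a i j k *: tnth eps k +
         \sum_(k < q) b i j k *: tnth delta k)
    (br_one_delta : forall j : 'I_q,
       br 1 (tnth delta j) =
         \sum_(k < p) c j k *: tnth eps k -
         \sum_(k < q) d j k *: tnth delta k) :
  (exists f : {linear A -> A}, averaging f /\ induced_by br f) <->
  (forall x y : A, br x y = x * br 1 y + y * br x 1) /\
  (exists x : 'cV[R]_p,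
     (\mxcol_(j < q) (\matrix_(k < q, i < p) b i j k)) *m x =
     \mxcol_(j < q) (\col_(k < q) d j k)).
Proof.
pose e (x : 'cV[R]_p) := \sum_(i < p) x i 0 *: tnth eps i.
have spanG : <<eps>>%VS = Gamma := span_basis eps_basis.
have eG x : e x \in Gamma.
  by rewrite -spanG; apply: rpred_sum => i _; apply/rpredZ/memv_span/mem_tnth.
have delta_systemP x j :
    br 1 (tnth delta j) + tnth delta j * e x \in Gamma <->
    forall k, \sum_(i < p) b i j k * x i 0 = d j k.
  (* Expansion in the basis [eps ++ delta]: because [d] enters [[1, delta_j]] with a minus sign, the
     coefficient of [delta_k] is the difference of the two sides of row [k] in block [j] of the
     system. *)
  have -> : br 1 (tnth delta j) + tnth delta j * e x =
      \sum_(k < p) (c j k + \sum_(i < p) x i 0 * a i j k) *: tnth eps k +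
      \sum_(k < q) (\sum_(i < p) b i j k * x i 0 - d j k) *: tnth delta k.
    rewrite br_one_delta mulA_comm mulr_suml.
    under [X in _ + X]eq_bigr => i _ do
      rewrite -scalerAl eps_mul_delta scalerDr !scaler_sumr.
    rewrite big_split /= [X in _ + (X + _)]exchange_big.
    rewrite [X in _ + (_ + X)]exchange_big /=.
    under [X in _ = X + _]eq_bigr do rewrite scalerDl scaler_suml.
    under [X in _ = _ + X]eq_bigr do rewrite scalerBl scaler_suml.
    rewrite big_split sumrB /= addrACA [- _ + _]addrC.
    congr (_ + _ + (_ - _)); apply: eq_bigr => k _; apply: eq_bigr => i _.
      by rewrite scalerA.
    by rewrite scalerA mulrC.
  rewrite -spanG; apply: (iff_trans (sum_free_cat_mem _ _ _)).
    exact: basis_free eps_delta_basis.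
  by split=> dE k; [apply/subr0_eq/dE | rewrite dE subrr].
have systemP (x : 'cV[R]_p) :
    (\mxcol_(j < q) (\matrix_(k < q, i < p) b i j k)) *m x =
      \mxcol_(j < q) (\col_(k < q) d j k) <->
    forall j, br 1 (tnth delta j) + tnth delta j * e x \in Gamma.
  rewrite mxcol_mul; split=> [/eq_mxcolP bxd j | eP].
    apply/delta_systemP => k; have /matrixP/(_ k 0) := bxd j.
    by rewrite !mxE => <-; apply: eq_bigr => i _; rewrite mxE.
  apply/eq_mxcolP => j; apply/matrixP => k o; rewrite ord1 !mxE.
  rewrite -((delta_systemP _ _).1 (eP j)).
  by apply: eq_bigr => i _; rewrite mxE.
split=> [[f [f_avg br_f]] | [br_br1 [x /systemP deltaG]]].
  have fG z : f z \in Gamma by apply/GammaP/averaging_in_Gamma.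
  split; first exact: induced_by_br1.
  (* Since [f y = [1, y] + y * f 1], the shift must be [f 1]. It lies in Gamma, so its
     [eps]-coordinates solve the system. *)
  exists (\col_i coord eps i (f 1)); apply/systemP => j.
  have -> : e (\col_i coord eps i (f 1)) = f 1.
    rewrite [RHS](coord_basis eps_basis (fG 1)).
    by apply: eq_bigr => i _; rewrite mxE -tnth_nth.
  by rewrite -(induced_byE br_f).
pose f : {linear A -> A} := br 1 \+ (e x \*o idfun).
have fE y : f y = br 1 y + y * e x by rewrite /= [y * _]mulA_comm.
have fG y : f y \in Gamma.
  have : y \in <<eps ++ delta>>%VS by rewrite (span_basis eps_delta_basis) memvf.
  (* Split [y = u + v] with [u] in Gamma and [v] in the span of [delta]. *)
  rewrite span_cat spanG => /memv_addP[u uG [v /coord_span-> ->]].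
  rewrite linearD rpredD //.
    (* Here [[1, u] = 0], so [f u = u * e x] is a product of two elements of Gamma. *)
    rewrite fE (in_Gamma_br1 br_lie) ?add0r; last exact/GammaP.
    by apply/GammaP/in_GammaM; apply/GammaP.
  (* On the span of [delta] it suffices to treat each [delta_j], which is what the system
     guarantees. *)
  rewrite linear_sum; apply: rpred_sum => j _.
  by rewrite linearZ /= rpredZ // -tnth_nth [_ + _]fE; apply: deltaG.
exists f; split; last exact: shift_induced_by fE.
by apply: shift_averaging fE _ => // y; apply/GammaP.
Qed.
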